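(* Let $E$ be a Banach sequence space whose canonical basis is $1$-unconditional and boundedly complete, and let $(X_n)_{n=1}^\infty$ be a sequence of Banach spaces such that $X_n^*$ is separable for every $n\in\mathbb N$. Then every bounded convex subset of $X:=\left[\bigoplus_{n=1}^\infty X_n\right]_E$ has a countable $\pi$-base for its relative weak topology.
   Context: All spaces are over $\mathbb K\in\{\mathbb R,\mathbb C\}$. $E$ is a Banach space of scalar sequences for which the canonical unit vectors $(e_n)_{n=1}^\infty$ form a Schauder basis. The basis is $1$-unconditional if for every $N\in\mathbb N$ and all scalars with $|a_j|\le|b_j|$ for $1\le j\le N$ one has $\left\|\sum_{j=1}^N a_je_j\right\|\le\left\|\sum_{j=1}^N b_je_j\right\|$; it is boundedly complete if $\sum_{j=1}^\infty a_je_j$ converges whenever $\sup_{n\in\mathbb N}\left\|\sum_{j=1}^n a_je_j\right\|<\infty$. $\left[\bigoplus_{n=1}^\infty X_n\right]_E$ is the Banach space of all sequences $(x_n)_{n=1}^\infty$ with $x_n\in X_n$ and $(\|x_n\|)_{n=1}^\infty\in E$, with norm $\|(x_n)_{n=1}^\infty\|=\left\|(\|x_n\|)_{n=1}^\infty\right\|_E$. A $\pi$-base for a topological space $(T,\tau)$ is a family $\mathcal U$ of nonempty open subsets of $T$ such that every nonempty open subset of $T$ contains some member of $\mathcal U$; the space has a countable $\pi$-base if $\mathcal U$ can be chosen countable. *)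

(* Defs.v *)
From HB Require Import structures.
From mathcomp Require Import all_boot all_order all_algebra.
From mathcomp Require Import all_classical all_reals all_analysis.

Set Implicit Arguments.
Unset Strict Implicit.
Unset Printing Implicit Defensive.

Import Order.TTheory GRing.Theory Num.Theory.
Import numFieldNormedType.Exports.

Local Open Scope classical_set_scope.
Local Open Scope ring_scope.

Definition pi_base (T : topologicalType) (U : set (set T)) : Prop :=
  (forall A, U A -> open A /\ A !=set0) /\
  (forall O : set T, open O -> O !=set0 -> exists2 A, U A & A `<=` O).

Definition has_countable_pi_base (T : topologicalType) : Prop :=
  exists2 U : set (set T), countable U & pi_base U.

Section Dual.
Variables (K : numFieldType) (V : normedModType K).

Record dual := Dual {
  dual_fun :> {linear V -> K^o};
  dual_continuous : continuous dual_fun }.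

(* [supremum 0 A] is the least upper bound of [A] for the (partial) order of
   [K] when there is one. When [K] is [R] or [R[i]] with [R : realType], the
   values of the norm are real and nonnegative, so that for a continuous linear
   [f] this is the usual operator norm, seen as an element of [K]. *)
Definition opnorm (f : V -> K^o) : K :=
  supremum 0 [set `|f x| | x in [set x : V | `|x| <= 1]].

Definition dual_separable : Prop :=
  exists2 D : set dual, countable D &
    forall (f : dual) (e : K), 0 < e ->
      exists2 g, D g & opnorm (fun x => f x - g x) < e.

(* [V] with the coarsest topology that makes every element of its dual
   continuous. *)
Definition weak : Type := V.

HB.instance Definition _ := Choice.on weak.
HB.instance Definition _ := Topological.copy weak
  (sup_topology (fun f : dual =>
     Topological.class (initial_topology (dual_fun f : V -> K^o)))).

End Dual.

Definition schauder_basis (K : numFieldType) (V : normedModType K)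
    (e : nat -> V) : Prop :=
  forall x : V, exists! a : nat -> K,
    series (fun j => a j *: e j) @ \oo --> x.

(* A Banach space [E] of scalar sequences: [coord] is the inclusion of [E] into
   the space of all sequences, indexed from 0. [unit_vec_expansion] says that
   the coefficients of [x] in the basis are the terms of the sequence [x]; it is
   automatic if, as usual, the coordinate functionals are continuous. *)
Record seqSpace (K : numFieldType) := SeqSpace {
  seqSpace_car :> completeNormedModType K;
  coord : {linear seqSpace_car -> (nat -> K^o)};
  coord_inj : injective coord;
  unit_vec : nat -> seqSpace_car;
  coord_unit_vec : forall n, coord (unit_vec n) = (fun j => (j == n)%:R);
  unit_vec_schauder : schauder_basis unit_vec;
  unit_vec_expansion : forall x,
    series (fun j => coord x j *: unit_vec j) @ \oo --> x }.

Arguments coord {K s}.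
Arguments coord_inj {K s}.

Section SeqSpace.
Variables (K : numFieldType) (E : seqSpace K).

Definition one_unconditional : Prop :=
  forall (N : nat) (a b : nat -> K),
    (forall j, (j < N)%N -> `|a j| <= `|b j|) ->
    `|\sum_(j < N) a j *: unit_vec E j| <= `|\sum_(j < N) b j *: unit_vec E j|.

Definition boundedly_complete : Prop :=
  forall a : nat -> K,
    bounded_fun (series (fun j => a j *: unit_vec E j)) ->
    cvgn (series (fun j => a j *: unit_vec E j)).

Lemma coordP (x : E) (a : nat -> K) :
  series (fun j => a j *: unit_vec E j) @ \oo --> x -> coord x = a.
Proof.
move=> xa; have [b [_ bu]] := @unit_vec_schauder K E x.
by rewrite -(bu _ xa) -(bu _ (@unit_vec_expansion K E x)).
Qed.

Lemma norm_le_cvg (u v : nat -> E) (x y : E) :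
  u @ \oo --> x -> v @ \oo --> y -> (forall n, `|u n| <= `|v n|) ->
  `|x| <= `|y|.
Proof.
move=> ux vy uv; rewrite real_leNgt ?normr_real//; apply/negP => yx.
have d0 : 0 < (`|x| - `|y|) / 2 by rewrite divr_gt0// subr_gt0.
move/cvgrPdist_lt : ux => /(_ _ d0) ux; move/cvgrPdist_lt : vy => /(_ _ d0) vy.
near \oo => n.
have un : `|x - u n| < (`|x| - `|y|) / 2 by near: n.
have vn : `|y - v n| < (`|x| - `|y|) / 2 by near: n.
have h1 : `|x| <= `|x - u n| + `|u n|.
  by rewrite -{1}(subrK (u n) x) ler_normD.
have h2 : `|v n| <= `|y - v n| + `|y|.
  by have := ler_normB y (y - v n); rewrite subKr addrC.
have : `|x| < `|x|.
  apply: (le_lt_trans h1); have -> : `|x| = (`|x| - `|y|) / 2 +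
    ((`|x| - `|y|) / 2 + `|y|) :> K by rewrite addrA -splitr subrK.
  apply: ltr_leD => //; apply: (le_trans (uv n)); apply: (le_trans h2).
  by rewrite lerD2r ltW.
by rewrite ltxx.
Unshelve. all: by end_near. Qed.

Hypothesis hE : one_unconditional.

Lemma one_unconditional_nat (m n : nat) (a b : nat -> K) :
  (forall j, `|a j| <= `|b j|) ->
  `|\sum_(m <= j < n) a j *: unit_vec E j| <=
  `|\sum_(m <= j < n) b j *: unit_vec E j|.
Proof.
move=> ab.
have E0 (c : nat -> K) : \sum_(m <= j < n) c j *: unit_vec E j =
    \sum_(j < n) (if (m <= j)%N then c j else 0) *: unit_vec E j.
  rewrite -(big_mkord xpredT
    (fun j => (if (m <= j)%N then c j else 0) *: unit_vec E j)).
  case: (leqP m n) => mn.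
    rewrite [RHS](big_cat_nat (n := m))//= [X in _ = X + _]big_nat_cond.
    rewrite [X in _ = X + _]big1 ?add0r; last first.
      by move=> j /andP[/andP[_ jm] _]; rewrite leqNgt jm scale0r.
    by apply: eq_big_nat => j /andP[-> _].
  rewrite (big_geq (ltnW mn)).
  rewrite big_nat_cond big1// => j /andP[/andP[_ jn] _].
  by rewrite leqNgt (ltn_trans jn mn) scale0r.
rewrite !E0; apply: (hE (a := fun j => if (m <= j)%N then a j else 0)
  (b := fun j => if (m <= j)%N then b j else 0)) => j _.
by case: ifP => [_|_]; rewrite ?normr0.
Qed.

Lemma seqSpace_solid (z : E) (a : nat -> K) :
  (forall j, `|a j| <= `|coord z j|) ->
  exists2 w : E, coord w = a & `|w| <= `|z|.
Proof.
move=> az; pose s := series (fun j => a j *: unit_vec E j).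
have cs : cvg (s @ \oo).
  apply: cauchy_cvg; apply/cauchy_seriesP => e e0.
  have /cvg_cauchy/cauchy_seriesP/(_ _ e0) :
    cvg (series (fun j => coord z j *: unit_vec E j) @ \oo).
    by apply/cvg_ex; exists z; exact: (@unit_vec_expansion K E z).
  apply: filterS => -[m n] /=; apply: le_lt_trans.
  exact: one_unconditional_nat.
exists (limn s); first exact: coordP.
apply: (norm_le_cvg cs (@unit_vec_expansion K E z)) => n.
by rewrite /s /series/=; exact: one_unconditional_nat.
Qed.

End SeqSpace.

(* The underlying set of the E-sum of the [X n]. The hypothesis [hE] is not used
   in the record, but makes it a normed space. *)
Record dsum (K : numFieldType) (E : seqSpace K) (hE : one_unconditional E)
    (X : nat -> completeNormedModType K) := DSum {
  dsum_val :> forall n, X n;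
  dsum_mem : exists z : E, coord z = (fun n => `|dsum_val n|) }.

HB.instance Definition _ (K : numFieldType) (E : seqSpace K)
  (hE : one_unconditional E) (X : nat -> completeNormedModType K) :=
  gen_eqMixin (dsum hE X).
HB.instance Definition _ (K : numFieldType) (E : seqSpace K)
  (hE : one_unconditional E) (X : nat -> completeNormedModType K) :=
  gen_choiceMixin (dsum hE X).

Section DirectSum.
Variables (K : numFieldType) (E : seqSpace K) (hE : one_unconditional E).
Variable X : nat -> completeNormedModType K.
Implicit Types x y z : dsum hE X.

Lemma dsumP x y : (forall n, x n = y n) -> x = y.
Proof.
case: x y => [x mx] [y my] /= xy.
have {}xy : x = y by apply: functional_extensionality_dep.
by subst y; congr DSum; exact: Prop_irrelevance.
Qed.

Definition norm_seq x : E := sval (cid (dsum_mem x)).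

Lemma coord_norm_seq x : coord (norm_seq x) = (fun n => `|x n|).
Proof. by rewrite /norm_seq; case: cid. Qed.

Definition dsum_norm x : K := `|norm_seq x|.

Lemma dsum0_mem : exists z : E, coord z = (fun n => `|0 : X n|).
Proof. by exists 0; rewrite linear0; apply/funext => n; rewrite normr0. Qed.

Lemma dsumN_mem x : exists z : E, coord z = (fun n => `|- x n|).
Proof.
by exists (norm_seq x); rewrite coord_norm_seq; apply/funext => n; rewrite normrN.
Qed.

Lemma dsumD_le x y n :
  `| `|x n + y n| : K| <= `|coord (norm_seq x + norm_seq y) n|.
Proof.
rewrite linearD/= !coord_norm_seq/= normr_id ger0_norm ?addr_ge0//.
exact: ler_normD.
Qed.

Lemma dsumD_mem x y : exists z : E, coord z = (fun n => `|x n + y n|).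
Proof.
by have [w wE _] := seqSpace_solid hE (dsumD_le x y); exists w; rewrite wE.
Qed.

Lemma dsumZ_mem (k : K) x : exists z : E, coord z = (fun n => `|k *: x n|).
Proof.
exists (`|k| *: norm_seq x); rewrite linearZ/= coord_norm_seq.
by apply/funext => n; rewrite normrZ.
Qed.

Definition dsum0 : dsum hE X := DSum hE dsum0_mem.
Definition dsumN x : dsum hE X := DSum hE (dsumN_mem x).
Definition dsumD x y : dsum hE X := DSum hE (dsumD_mem x y).
Definition dsumZ k x : dsum hE X := DSum hE (dsumZ_mem k x).

Lemma dsumDA : associative dsumD.
Proof. by move=> x y z; apply: dsumP => n /=; rewrite addrA. Qed.
Lemma dsumDC : commutative dsumD.
Proof. by move=> x y; apply: dsumP => n /=; rewrite addrC. Qed.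
Lemma dsum0D : left_id dsum0 dsumD.
Proof. by move=> x; apply: dsumP => n /=; rewrite add0r. Qed.
Lemma dsumND : left_inverse dsum0 dsumN dsumD.
Proof. by move=> x; apply: dsumP => n /=; rewrite addNr. Qed.

HB.instance Definition _ :=
  GRing.isZmodule.Build (dsum hE X) dsumDA dsumDC dsum0D dsumND.

Lemma dsumZA a b x : dsumZ a (dsumZ b x) = dsumZ (a * b) x.
Proof. by apply: dsumP => n /=; rewrite scalerA. Qed.
Lemma dsum1Z : left_id 1 dsumZ.
Proof. by move=> x; apply: dsumP => n /=; rewrite scale1r. Qed.
Lemma dsumZDr : right_distributive dsumZ +%R.
Proof. by move=> k x y; apply: dsumP => n /=; rewrite scalerDr. Qed.
Lemma dsumZDl x : {morph dsumZ^~ x : a b / a + b}.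
Proof. by move=> a b; apply: dsumP => n /=; rewrite scalerDl. Qed.

HB.instance Definition _ :=
  GRing.Zmodule_isLmodule.Build K (dsum hE X) dsumZA dsum1Z dsumZDr dsumZDl.

Lemma dsum_ler_normD x y : dsum_norm (x + y) <= dsum_norm x + dsum_norm y.
Proof.
have [w wE wle] := seqSpace_solid hE (dsumD_le x y).
have -> : dsum_norm (x + y) = `|w|.
  by congr `|_|; apply: coord_inj; rewrite wE coord_norm_seq.
exact/(le_trans wle)/ler_normD.
Qed.

Lemma dsum_normrZ (k : K) x : dsum_norm (k *: x) = `|k| * dsum_norm x.
Proof.
have kx : norm_seq (k *: x) = `|k| *: norm_seq x.
  apply: coord_inj; rewrite linearZ/= !coord_norm_seq.
  by apply/funext => n /=; rewrite normrZ.
by rewrite /dsum_norm kx normrZ normr_id.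
Qed.

Lemma dsum_normr0_eq0 x : dsum_norm x = 0 -> x = 0.
Proof.
move=> /normr0_eq0 x0; apply: dsumP => n; apply: normr0_eq0.
have /(congr1 (fun f => f n)) /= <- := coord_norm_seq x.
by rewrite x0 linear0.
Qed.

HB.instance Definition _ :=
  Lmodule_isNormed.Build K (dsum hE X)
    dsum_ler_normD dsum_normrZ dsum_normr0_eq0.

End DirectSum.

(* Main.v *)
(* Every nonempty relatively weakly open subset of C contains a nonempty
   relatively weakly open set on which the tails beyond some N have small norm:
   otherwise, since the norm of each coordinate is weakly lower semicontinuous
   (Hahn-Banach), one builds inductively a scalar sequence whose partial sums are
   bounded but have infinitely many disjoint blocks of norm bounded below, which
   contradicts bounded completeness. On a set with small tails, a weak
   neighbourhood is controlled by the first N coordinates, where countably many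
   functionals suffice because the duals of the X n are separable. Hence the
   nonempty relative weak interiors of the sets
     B `&` [set x | the tail of x beyond N has norm < |r|],
   with B a finite intersection of balls given by these functionals and with r
   in a countable dense set of scalars, form a countable pi-base. *)
Require Import Defs.
From HB Require Import structures.
From mathcomp Require Import all_boot all_order all_algebra.
From mathcomp Require Import all_classical all_reals all_analysis.
From mathcomp.real_closed Require Import complex.
From mathcomp Require Import ring lra.
Import numFieldNormedType.Exports.
Import Order.TTheory GRing.Theory Num.Theory.
Local Open Scope classical_set_scope.
Local Open Scope ring_scope.

Set Implicit Arguments.
Unset Strict Implicit.
Unset Printing Implicit Defensive.

(** * The real Hahn-Banach theorem for a seminorm *)

Section HahnBanach.
Variables (R : realType) (V : lmodType R) (p : V -> R).
Hypothesis pD : forall x y, p (x + y) <= p x + p y.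
Hypothesis pZ : forall a x, p (a *: x) = `|a| * p x.

Let pZ_ge0 (a : R) x : 0 <= a -> p (a *: x) = a * p x.
Proof. by move=> a0; rewrite pZ ger0_norm. Qed.

(** Encodes a linear functional on a subspace by its graph. Single-valuedness follows from the
    domination by [p]; the empty set is allowed. *)
Definition dominated_graph (G : set (V * R)) :=
  (forall k u v, G u -> G v -> G (k *: u.1 + v.1, k * u.2 + v.2)) /\
  (forall u, G u -> u.2 <= p u.1).

Lemma dominated_graph0 G u : dominated_graph G -> G u -> G (0, 0).
Proof.
move=> [lG _] Gu; have := lG (-1) _ _ Gu Gu.
by rewrite scaleN1r mulN1r !addNr.
Qed.

Lemma dominated_graphZ G k u : dominated_graph G -> G u ->
  G (k *: u.1, k * u.2).
Proof.
move=> dG Gu; have := dG.1 k _ _ Gu (dominated_graph0 dG Gu).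
by rewrite /= !addr0.
Qed.

(** Two values at one point differ by a value at 0, where [p] vanishes. *)
Lemma dominated_graph_fun G x a b : dominated_graph G ->
  G (x, a) -> G (x, b) -> a = b.
Proof.
move=> dG; suff le y c d : G (y, c) -> G (y, d) -> c <= d.
  by move=> xa xb; apply/eqP; rewrite eq_le (le _ _ _ xa xb) (le _ _ _ xb xa).
move=> yc yd; have := dG.2 _ (dG.1 (-1) _ _ yd yc).
rewrite /= scaleN1r addNr -[X in p X](scale0r (0 : V)) pZ normr0 mul0r; lra.
Qed.

(** Subadditivity puts every [u.2 - p (u.1 - x1)] below every [p (v.1 + x1) - v.2]. Any number in
    between can be the value at [x1]; [sup L] is one. *)
Lemma dominated_graph_extend G x1 : dominated_graph G -> G (0, 0) ->
  exists2 G', dominated_graph G' & G `<=` G' /\ exists c, G' (x1, c).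
Proof.
move=> dG G0.
pose L := [set u.2 - p (u.1 - x1) | u in G].
have LU u v : G u -> G v -> u.2 - p (u.1 - x1) <= p (v.1 + x1) - v.2.
  move=> Gu Gv; have := dG.2 _ (dG.1 1 _ _ Gu Gv).
  rewrite /= scale1r mul1r => h; have := pD (u.1 - x1) (v.1 + x1).
  by rewrite addrACA addNr addr0; lra.
have L0 : L !=set0 by exists ((0 : R) - p (0 - x1)), (0, 0).
have Lub u : G u -> u.2 - p (u.1 - x1) <= sup L.
  move=> Gu; apply: ub_le_sup; last by exists u.
  by exists (p (0 + x1) - 0) => _ [v Gv <-]; exact: (LU _ (0, 0)).
have supL u : G u -> sup L <= p (u.1 + x1) - u.2.
  by move=> Gu; apply: ge_sup => // _ [v Gv <-]; exact: LU.
exists [set w | exists2 u, G u & exists t, w = (u.1 + t *: x1, u.2 + t * sup L)].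
  split=> [k _ _ [u Gu [t ->]] [v Gv [s ->]]|_ [u Gu [t ->]]]/=.
    exists (k *: u.1 + v.1, k * u.2 + v.2); first exact: dG.1.
    exists (k * t + s); congr pair => /=; last by ring.
    by rewrite scalerDr scalerDl scalerA addrACA.
  (* For nonzero [t], dividing by [|t|] reduces the domination to one of the two bounds on
     [sup L]. *)
  have [t0|t0|->] := ltgtP t 0; last by rewrite scale0r addr0 mul0r addr0 dG.2.
  - have s0 : 0 < - t by lra.
    have := Lub _ (dominated_graphZ (- t)^-1 dG Gu).
    rewrite /= -(ler_pM2l s0) mulrBr mulrA divff ?lt0r_neq0// mul1r.
    rewrite -(pZ_ge0 _ (ltW s0)) scalerBr scalerA divff ?lt0r_neq0//.
    by rewrite scale1r scaleNr opprK; lra.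
  - have := supL _ (dominated_graphZ t^-1 dG Gu).
    rewrite /= -(ler_pM2l t0) mulrBr mulrA divff ?lt0r_neq0// mul1r.
    rewrite -(pZ_ge0 _ (ltW t0)) scalerDr scalerA divff ?lt0r_neq0//.
    by rewrite scale1r; lra.
split=> [u Gu|]; last first.
  by exists (sup L), (0, 0) => //; exists 1; rewrite /= scale1r mul1r !add0r.
by exists u => //; exists 0; rewrite scale0r mul0r !addr0; case: u Gu.
Qed.

Lemma Hahn_Banach (x0 : V) : exists f : V -> R,
  [/\ forall k x y, f (k *: x + y) = k * f x + f y,
      forall x, f x <= p x & f x0 = p x0].
Proof.
have p0 x : 0 <= p x.
  have := pD x ((-1) *: x); rewrite pZ normrN1 mul1r scaleN1r subrr.
  by rewrite -[X in p X](scale0r (0 : V)) pZ normr0 mul0r; lra.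
(* The implication lets the empty graph satisfy [P], as Zorn's lemma demands for the empty chain. *)
pose P G := dominated_graph G /\ (G !=set0 -> G (x0, p x0)).
have [G [[dG Gx0] maxG]] : exists A, P A /\ forall B, A `<` B -> ~ P B.
  apply: Zorn_bigcup => F FP totF; split; last first.
    by move=> [u [A FA Au]]; exists A => //; apply: (FP _ FA).2; exists u.
  split=> [k u v [A FA Au] [B FB Bv]|u [A FA Au]]; last exact: (FP _ FA).1.2.
  have [AB|BA] := totF _ _ FA FB.
  - by exists B => //; apply: (FP _ FB).1.1 => //; exact: AB.
  - by exists A => //; apply: (FP _ FA).1.1 => //; exact: BA.
(* A maximal graph is nonempty: otherwise the line spanned by [(x0, p x0)] would be strictly
   larger. *)
have {}Gx0 : G (x0, p x0).
  have [G0|/set0P/Gx0//] := eqVneq G set0; exfalso.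
  pose G1 := range (fun t : R => (t *: x0, t * p x0)).
  have G1x : G1 (x0, p x0) by exists 1 => //; rewrite scale1r mul1r.
  apply: (maxG G1).
    by rewrite G0; split=> // sG1; exact: sG1 G1x.
  split=> [|_ //]; split=> [k _ _ [t _ <-] [s _ <-]|_ [t _ <-]]/=.
    by exists (k * t + s) => //; rewrite scalerDl scalerA mulrDl mulrA.
  by rewrite pZ ler_wpM2r// ler_norm.
have G0 := dominated_graph0 dG Gx0.
(* By maximality the one-step extension adds nothing, so the domain is all of [V]. *)
have tot x : exists a, G (x, a).
  have [G' dG' [GG' [c G'c]]] := dominated_graph_extend x dG G0.
  have [GE|GE] := pselect (G' `<=` G); first by exists c; exact: GE.
  exfalso; apply: (maxG G'); first by split.
  by split=> // _; exact: GG'.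
have [f fG] := choice tot.
exists f; split=> [k x y|x|].
- exact: dominated_graph_fun dG (fG _) (dG.1 k _ _ (fG x) (fG y)).
- exact: dG.2 (fG x).
- exact: dominated_graph_fun dG (fG _) Gx0.
Qed.
End HahnBanach.

(** * Norming functionals over the real and the complex scalars *)

Lemma linear_le_continuous (K : numFieldType) (V W : normedModType K)
    (f : {linear V -> W}) (M : K) : 0 <= M ->
  (forall x, `|f x| <= M * `|x|) -> continuous f.
Proof.
move=> M0 fM; apply: bounded_linear_continuous; apply/linear_boundedP.
exists M; split; first exact: ger0_real.
by move=> r Mr x; apply: (le_trans (fM x)); rewrite ler_wpM2r// ltW.
Qed.

Lemma ex_dual (K : numFieldType) (V : normedModType K) (f : V -> K) (M : K) :
  0 <= M -> (forall k x y, f (k *: x + y) = k * f x + f y) ->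
  (forall x, `|f x| <= M * `|x|) -> exists g : dual V, forall x, g x = f x.
Proof.
move=> M0 fL fM.
pose F : {linear V -> K^o} :=
  HB.pack (f : V -> K^o) (GRing.isLinear.Build K V K^o *:%R f fL).
by exists (Dual (@linear_le_continuous _ _ _ F _ M0 fM)).
Qed.

(** The consequence of Hahn-Banach used later, stated for a general [K] so that one argument serves
    both scalar fields. *)
Definition norming (K : numFieldType) := forall (V : normedModType K) (x0 : V),
  exists f : dual V, (forall x, `|f x| <= `|x|) /\ `|f x0| = `|x0|.

Lemma norming_real (R : realType) : norming (R : numFieldType).
Proof.
move=> V x0.
have [||f [fL fle fx0]] := @Hahn_Banach R V (fun x => `|x|) _ _ x0.
- exact: ler_normD.
- exact: normrZ.
have f0 : f 0 = 0 by have := fL 1 0 0; rewrite scale1r addr0 mul1r; lra.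
have fN x : f (- x) = - f x.
  by have := fL (-1) x 0; rewrite scaleN1r addr0 f0; lra.
have fle' x : `|f x| <= `|x|.
  by rewrite ler_norml fle lerNl -fN -(normrN x) fle.
have [||g gf] := @ex_dual _ V f 1 _ fL; rewrite ?ler01//.
  by move=> x; rewrite mul1r.
by exists g; split=> [x|]; rewrite gf// fx0 normr_id.
Qed.

(* Restriction of scalars, to which the real Hahn-Banach theorem applies; the
   complex functional is then recovered as [u x - 'i u ('i x)]. *)
Section Realification.
Variables (R : realType) (V : lmodType R[i]).

Definition realification : Type := V.
HB.instance Definition _ := GRing.Zmodule.on realification.

Let scale (r : R) (v : realification) : realification := (r%:C)%C *: (v : V).

Fact realification_scalerA a b v : scale a (scale b v) = scale (a * b) v.
Proof. by rewrite /scale scalerA rmorphM. Qed.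
Fact realification_scale1r : left_id 1 scale.
Proof. by move=> v; rewrite /scale rmorph1 scale1r. Qed.
Fact realification_scalerDr : right_distributive scale +%R.
Proof. by move=> a u v; rewrite /scale scalerDr. Qed.
Fact realification_scalerDl v : {morph scale^~ v : a b / a + b}.
Proof. by move=> a b; rewrite /scale rmorphD scalerDl. Qed.
HB.instance Definition _ := GRing.Zmodule_isLmodule.Build R realification
  realification_scalerA realification_scale1r
  realification_scalerDr realification_scalerDl.

Lemma realification_scaleE (r : R) (v : realification) :
  r *: v = ((r%:C)%C *: (v : V)) :> V.
Proof. by []. Qed.
End Realification.

Lemma norming_complex (R : realType) : norming (R[i] : numFieldType).
Proof.
move=> V x0.
pose p (v : realification V) : R := complex.Re `|v : V|.
have pE v : (p v)%:C%C = `|v : V|.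
  by rewrite /p RRe_real// normr_real.
have [||u [uL ule ux0]] := @Hahn_Banach R (realification V) p _ _ x0.
- move=> x y; rewrite -lecR rmorphD/= !pE; exact: ler_normD.
- move=> a x; apply: complexI; rewrite rmorphM/= !pE realification_scaleE normrZ.
  by congr (_ * _); rewrite normc_def/= expr0n addr0 sqrtr_sqr.
pose J (x : V) : V := 'i%C *: x.
pose f (x : V) : R[i] := (u x +i* (- u (J x)))%C.
have u0 : u 0 = 0 by have := uL 1 0 0; rewrite scale1r addr0 mul1r; lra.
have uD x y : u (x + y) = u x + u y.
  by have := uL 1 x y; rewrite scale1r mul1r.
have uZ a x : u ((a%:C)%C *: x) = a * u x.
  by have := uL a x 0; rewrite !addr0 u0 addr0.
have fL (k : R[i]) (x y : V) : f (k *: x + y) = k * f x + f y.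
  rewrite /f.
  have -> : u (k *: x + y) = complex.Re k * u x + complex.Im k * u (J x) + u y.
    rewrite uD {1}(complexE k) scalerDl uD uZ.
    by rewrite ['i%C * _]mulrC -scalerA uZ.
  have -> : u (J (k *: x + y)) =
      complex.Re k * u (J x) - complex.Im k * u x + u (J y).
    rewrite /J scalerDr uD scalerA {1}(complexE k) mulrDr scalerDl uD.
    rewrite ['i%C * (complex.Re k)%:C%C]mulrC -(scalerA (complex.Re k)%:C%C) uZ.
    rewrite ['i%C * ('i%C * _)]mulrA -expr2 sqr_i mulN1r -rmorphN uZ.
    by rewrite mulNr.
  case: k => a b /=; apply/eqP; rewrite eq_complex/=; apply/andP.
  by split; apply/eqP; ring.
have fle (x : V) : `|f x| <= `|x|.
  have [->|fx0] := eqVneq (f x) 0; first by rewrite normr0.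
  (* Rotating [x] by the unimodular [w] makes the value of [f] real, so that it equals [u (w *: x)]
     and is bounded by [p]. *)
  pose w := `|f x| / f x.
  have w1 : `|w| = 1 by rewrite normf_div normr_id divff// normr_eq0.
  have fw : f (w *: x) = `|f x|.
    have := fL w x 0; rewrite addr0 => ->.
    have -> : f 0 = 0 by rewrite /f /J scaler0 u0 oppr0.
    by rewrite addr0 divfK.
  have -> : `|f x| = (u (w *: x))%:C%C.
    have /complex_realP[k fk] : `|f x| \is Num.real by exact: normr_real.
    by rewrite fk; congr (_%:C)%C; move: fw; rewrite fk => -[].
  by rewrite (le_trans (y := (p (w *: x))%:C%C)) ?lecR ?ule// pE normrZ w1 mul1r.
have [||g gf] := @ex_dual _ V f 1 _ fL; rewrite ?ler01//.
  by move=> x; rewrite mul1r.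
exists g; split=> [x|]; rewrite gf//; apply/eqP; rewrite eq_le fle/=.
(* The norm of [x0] equals [u x0], which is the real part of [f x0]. *)
rewrite -pE -ux0 (le_trans _ (normc_ge_Re _))//= lecR; exact: ler_norm.
Qed.

(** * Suprema, the operator norm and countable dense sets of scalars *)

Definition has_suprema (K : numFieldType) := forall A : set K, A !=set0 ->
  (forall x, A x -> 0 <= x) -> has_ubound A -> supremums A !=set0.

Lemma has_suprema_real (R : realType) : has_suprema (R : numFieldType).
Proof.
move=> A A0 _ Aub; exists (sup A).
split=> [x Ax|y Ay]; [exact: ub_le_sup|exact: ge_sup].
Qed.

(** Nonnegative complex numbers are real, and so is every upper bound of a nonempty set of them; the
    supremum of the real parts therefore works. *)
Lemma has_suprema_complex (R : realType) : has_suprema (R[i] : numFieldType).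
Proof.
move=> A [a Aa] A0 [M AM].
have AR x : A x -> x = (complex.Re x)%:C%C.
  by move=> Ax; rewrite RRe_real// ger0_real// A0.
have B0 : (@complex.Re R @` A) !=set0 by exists (complex.Re a), a.
have Bub y : ubound A y -> ubound (@complex.Re R @` A) (complex.Re y).
  by move=> Ay _ [x Ax <-]; have := Ay _ Ax; rewrite lecE => /andP[].
exists (sup (@complex.Re R @` A))%:C%C; split=> [x Ax|y Ay].
  rewrite (AR _ Ax) lecR; apply: ub_le_sup; last by exists x.
  by exists (complex.Re M); exact: Bub.
have /RRe_real <- : y \is Num.real.
  by rewrite ger0_real// (le_trans (A0 _ Aa))// Ay.
by rewrite lecR ge_sup//; exact: Bub.
Qed.

(** Continuity bounds the values on the unit ball, so their least upper bound exists and [supremum]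
    does not fall back on its default 0. The rest is homogeneity. *)
Lemma le_opnorm (K : numFieldType) (V : normedModType K)
    (h : {linear V -> K^o}) :
  has_suprema K -> continuous h -> forall x, `|h x| <= opnorm h * `|x|.
Proof.
move=> supK hc x.
set A := [set `|h x| | x in [set x : V | `|x| <= 1]].
have hA y : `|y| <= 1 -> `|h y| <= opnorm h.
  move=> y1.
  have /linear_bounded_continuous/linear_boundedP/pinfty_ex_gt0[M M0 hM] := hc.
  have A0 : A !=set0 by exists `|h y|, y.
  have [||s sA] := supK _ A0.
  - by move=> _ [z _ <-].
  - exists M => _ [z /= z1 <-]; apply: (le_trans (hM z)).
    by rewrite -[leRHS]mulr1 ler_wpM2l// ltW.
  rewrite /opnorm /supremum; case: eqP => [AE|_].
    by move: A0; rewrite /A AE => -[].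
  have [+ _] : supremums A (xget 0 (supremums A)) := xgetI 0 sA.
  by apply; exists y.
have [->|x0] := eqVneq x 0; first by rewrite linear0 !normr0 mulr0.
have nx : 0 < `|x| by rewrite normr_gt0.
rewrite -ler_pdivrMr//; have := hA (`|x|^-1 *: x).
rewrite linearZ/= !normrZ normfV normr_id mulVf ?gt_eqF// mulrC; exact.
Qed.

Definition separable_scalars (K : numFieldType) (D : set K) :=
  countable D /\ forall z e : K, 0 < e -> exists2 q, D q & `|z - q| < e.

Lemma separable_scalars_real (R : realType) :
  exists D : set (R : numFieldType), separable_scalars D.
Proof.
exists (range (@ratr R)); split.
  exact: sub_countable (card_image_le _ _) (countableP _).
move=> z e e0.
have [q] := rat_in_itvoo (ltac:(lra) : z - e < z + e).
rewrite in_itv/= => /andP[q1 q2]; exists (ratr q); first by exists q.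
by rewrite ltr_norml; lra.
Qed.

Lemma separable_scalars_complex (R : realType) :
  exists D : set (R[i] : numFieldType), separable_scalars D.
Proof.
have [D [Dc Dd]] := separable_scalars_real R.
exists [set (u.1 +i* u.2)%C | u in D `*` D]; split.
  by apply: sub_countable (card_image_le _ _) _; exact: countableX.
move=> z e e0; have eE : e = (complex.Re e)%:C%C by rewrite RRe_real ?gtr0_real.
have e2 : 0 < complex.Re e / 2 by move: e0; rewrite eE ltcR => ?; lra.
have [a Da za] := Dd (complex.Re z) _ e2.
have [b Db zb] := Dd (complex.Im z) _ e2.
exists (a +i* b)%C; first by exists (a, b).
have -> : z - (a +i* b)%C =
    (complex.Re z - a)%:C%C + 'i%C * (complex.Im z - b)%:C%C.
  by rewrite [LHS]complexE; case: z {za zb}.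
apply: le_lt_trans (ler_normD _ _) _.
have nC (r : R) : `|r%:C%C| = `|r|%:C%C.
  by rewrite normc_def/= expr0n addr0 sqrtr_sqr.
have ni : `|'i%C : R[i]| = 1 by rewrite normc_def/= expr0n expr1n add0r sqrtr1.
rewrite normrM ni mul1r !nC -rmorphD eE ltcR.
by rewrite [ltRHS]splitr ltrD.
Qed.

(** * Weak neighbourhoods described by finite sums of functionals *)

Section WeakTopology.
Variables (K : numFieldType) (V : normedModType K).
Implicit Types (x : weak V) (f : dual V).

Lemma weak_dual_continuous f : continuous (f : weak V -> K^o).
Proof.
move=> x; have /= h := (@cvg_sup V (dual V) (fun f => Topological.class
  (initial_topology (f : V -> K^o))) (nbhs x) x _).1 (@cvg_refl _ (nbhs x)) f.
move=> A fA; apply: h.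
  exact: (@nbhs_filter (weak V) x).
exact: (@initial_continuous V K^o f x A fA).
Qed.

Lemma weak_nbhs_dual f x (e : K) : 0 < e ->
  nbhs x [set y : weak V | `|f (y : V) - f (x : V)| < e].
Proof.
move=> e0; have /cvgrPdist_lt/(_ _ e0) := @weak_dual_continuous f x.
by apply: filterS => y /=; rewrite distrC.
Qed.

(** These seminorms generate the weak topology; sums avoid maxima in the partially ordered [K]. *)
Definition weak_semi (fs : seq (dual V)) (z : V) : K := \sum_(f <- fs) `|f z|.

Lemma weak_semi_ge0 fs z : 0 <= weak_semi fs z.
Proof. exact: sumr_ge0. Qed.

Lemma weak_semiD fs y z :
  weak_semi fs (y + z) <= weak_semi fs y + weak_semi fs z.
Proof.
by rewrite -big_split/=; apply: ler_sum => f _; rewrite linearD ler_normD.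
Qed.

Lemma weak_semiN fs z : weak_semi fs (- z) = weak_semi fs z.
Proof. by apply: eq_bigr => f _; rewrite linearN normrN. Qed.

Lemma weak_semi_bounded fs : exists2 L : K, 0 < L &
  forall z, weak_semi fs z <= L * `|z|.
Proof.
elim: fs => [|f fs [L L0 fL]].
  by exists 1 => // z; rewrite /weak_semi big_nil mul1r.
have /linear_bounded_continuous/linear_boundedP/pinfty_ex_gt0[M M0 fM] :=
  @dual_continuous _ _ f.
exists (M + L); first exact: addr_gt0.
move=> z; rewrite /weak_semi big_cons mulrDl.
by apply: lerD; [exact: fM|exact: fL].
Qed.

Lemma weak_nbhs_semi fs x (e : K) : 0 < e ->
  nbhs x [set y : weak V | weak_semi fs ((y : V) - (x : V)) < e].
Proof.
elim: fs e => [|f fs ih] e e0.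
  by apply: filterS (filterT (F := nbhs x)) => y _ /=; rewrite /weak_semi big_nil.
have e2 : 0 < e / 2 by rewrite divr_gt0.
apply: filterS2 (weak_nbhs_dual f x e2) (ih _ e2) => y /= fy fsy.
by rewrite /weak_semi big_cons linearB [ltRHS]splitr ltrD.
Qed.

(** The sets containing a [weak_semi] ball around [x] form a filter. It converges to [x] in the
    initial topology of each functional, hence in their supremum, so it contains every weak
    neighbourhood. *)
Lemma weak_nbhsP x (A : set (weak V)) : nbhs x A -> exists fs, exists2 e : K,
  0 < e & forall y : V, weak_semi fs (y - (x : V)) < e -> A y.
Proof.
pose F : set_system (weak V) := [set A | exists fs, exists2 e : K,
  0 < e & forall y : V, weak_semi fs (y - (x : V)) < e -> A y].
have FF : Filter F.
  split=> [|B C [fs [e e0 eB]] [gs [d d0 dC]]|B C BC [fs [e e0 eB]]].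
  - by exists [::], 1.
  - have [m m0 [me md]] : exists2 m, 0 < m & m <= e /\ m <= d.
      have [ed|/ltW de] := real_leP (gtr0_real e0) (gtr0_real d0).
      + by exists e.
      + by exists d.
    exists (fs ++ gs), m => // y; rewrite /weak_semi big_cat/= => ym; split.
    + apply: eB; apply: (lt_le_trans _ me); apply: (le_lt_trans _ ym).
      by rewrite lerDl weak_semi_ge0.
    + apply: dC; apply: (lt_le_trans _ md); apply: (le_lt_trans _ ym).
      by rewrite lerDr weak_semi_ge0.
  - by exists fs, e => // y /eB /BC.
suff h : F --> x by exact: h.
apply: (@cvg_sup V (dual V) (fun f => Topological.class
  (initial_topology (f : V -> K^o))) F x _).2 => f B [_ [[U Uo <-] Ux UB]].
have /nbhs_ballP[e /= e0 eU] : nbhs (f x : K^o) U by exact: open_nbhs_nbhs.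
exists [:: f], e => // y; rewrite /weak_semi big_seq1 linearB => yx.
by apply: UB; apply: eU; rewrite /ball/= distrC.
Qed.
End WeakTopology.

(** * Coordinates, heads and tails in the direct sum *)

Section DirectSumTheory.
Variables (K : numFieldType) (E : seqSpace K) (hE : one_unconditional E).
Variable X : nat -> completeNormedModType K.
Local Notation T := (dsum hE X).
(* [coord] alone would denote the coordinate function of vector.v. *)
Local Notation coord := Defs.coord.
Implicit Types x y : T.

Definition psum (a : nat -> K) : nat -> E :=
  series (fun j => a j *: unit_vec E j).

Lemma psumS a n : psum a n.+1 = psum a n + a n *: unit_vec E n.
Proof. by rewrite /psum !seriesEnat/= big_nat_recr. Qed.

Lemma coord_psum a n :
  coord (psum a n) = (fun i => if (i < n)%N then a i else 0).
Proof.
elim: n => [|n ih]; first by rewrite /psum seriesEnat/= big_geq// linear0.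
rewrite psumS linearD linearZ/= ih coord_unit_vec; apply/funext => i.
rewrite -[LHS]/((if (i < n)%N then a i else 0) + a n * (i == n)%:R).
rewrite [in RHS]ltnS [in RHS]leq_eqVlt.
have [->|] := eqVneq i n; first by rewrite ltnn add0r mulr1.
by rewrite mulr0 addr0.
Qed.

Lemma psumZ k a n : psum (fun i => k * a i) n = k *: psum a n.
Proof.
rewrite /psum !seriesEnat/= scaler_sumr; apply: eq_bigr => i _.
by rewrite scalerA.
Qed.

Lemma eq_psumB a b m n : (forall i, (m <= i < n)%N -> a i = b i) -> (m <= n)%N ->
  psum a n - psum a m = psum b n - psum b m.
Proof.
move=> ab mn; rewrite /psum !sub_series mn.
by apply: eq_big_nat => i /ab ->.
Qed.

Lemma norm_unit_vec_gt0 n : 0 < `|unit_vec E n|.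
Proof.
rewrite normr_gt0; apply/eqP => e0.
have := congr1 (fun f => f n) (coord_unit_vec E n).
by rewrite e0 linear0 eqxx => /eqP; rewrite eq_sym oner_eq0.
Qed.

Lemma dsum_normE x : `|x| = `|norm_seq x|.
Proof. by []. Qed.

(** Solidity of the norm of [E], applied to [a] cut off at [n]. *)
Lemma psum_le_norm a n x : (forall i, (i < n)%N -> `|a i| <= `|x i|) ->
  `|psum a n| <= `|x|.
Proof.
move=> ax.
have [|w wE wx] := seqSpace_solid hE (z := norm_seq x)
    (a := fun i => if (i < n)%N then a i else 0).
  move=> i; rewrite coord_norm_seq normr_id.
  by case: ifP => [/ax|_]; rewrite ?normr0.
rewrite dsum_normE; suff -> : psum a n = w by [].
by apply: coord_inj; rewrite coord_psum.
Qed.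

(** Solidity again, for a sequence supported at [n]. This makes the coordinate projections bounded;
    the factor appears because unit vectors need not have norm 1. *)
Lemma dsum_coord_le n x : `|x n| * `|unit_vec E n| <= `|x|.
Proof.
have [|w wE wx] := seqSpace_solid hE (z := norm_seq x)
    (a := fun i => if i == n then `|x n| else 0).
  move=> i; rewrite coord_norm_seq normr_id.
  by case: ifP => [/eqP->|_]; rewrite ?normr_id// normr0.
rewrite dsum_normE -[leLHS]/(`|x n| * _) -{1}(normr_id (x n)) -normrZ.
suff <- : w = `|x n| *: unit_vec E n by [].
apply: coord_inj; rewrite wE linearZ/= coord_unit_vec; apply/funext => i.
rewrite -[RHS]/(`|x n| * (i == n)%:R).
by case: (i == n); rewrite ?mulr1 ?mulr0.
Qed.

Lemma dual_proj n (f : dual (X n)) : exists g : dual T, forall x, g x = f (x n).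
Proof.
have /linear_bounded_continuous/linear_boundedP/pinfty_ex_gt0[M M0 fM] :=
  @dual_continuous _ _ f.
apply: (@ex_dual _ T (fun x => f (x n)) (M / `|unit_vec E n|)).
- by rewrite divr_ge0// ltW.
- by move=> k x y; rewrite -linearP.
- move=> x; apply: (le_trans (fM _)); rewrite -mulrA ler_wpM2l ?(ltW M0)//.
  by rewrite ler_pdivlMl ?norm_unit_vec_gt0// mulrC dsum_coord_le.
Qed.

Lemma dsum_single_mem n (v : X n) :
  exists z : E, coord z = (fun i => `|dfwith (fun j => 0 : X j) n v i : X i|).
Proof.
exists (`|v| *: unit_vec E n); rewrite linearZ/= coord_unit_vec.
apply/funext => i; rewrite -[LHS]/(`|v| * (i == n)%:R).
case: dfwithP => [|j nj]; first by rewrite eqxx mulr1.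
by rewrite eq_sym (negbTE nj) mulr0 normr0.
Qed.

Definition dsum_single n (v : X n) : T := DSum hE (dsum_single_mem v).

Lemma dsum_singleP n k (u v : X n) :
  dsum_single (k *: u + v) = k *: dsum_single u + dsum_single v.
Proof.
apply: dsumP => i /=; case: dfwithP => [|j nj]; first by rewrite !dfwithin.
by rewrite !dfwithout// scaler0 addr0.
Qed.

Lemma norm_dsum_single n (v : X n) :
  `|dsum_single v| = `|v| * `|unit_vec E n|.
Proof.
rewrite dsum_normE -{1}(normr_id v) -normrZ; congr `|_|.
apply: coord_inj; rewrite coord_norm_seq linearZ/= coord_unit_vec.
apply/funext => i; rewrite -[RHS]/(`|v| * (i == n)%:R) /=.
case: dfwithP => [|j nj]; first by rewrite eqxx mulr1.
by rewrite eq_sym (negbTE nj) mulr0 normr0.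
Qed.

Lemma dual_single n (f : dual T) :
  exists g : dual (X n), forall v, g v = f (dsum_single v).
Proof.
have /linear_bounded_continuous/linear_boundedP/pinfty_ex_gt0[M M0 fM] :=
  @dual_continuous _ _ f.
apply: (@ex_dual _ _ (fun v => f (dsum_single v)) (M * `|unit_vec E n|)).
- by rewrite mulr_ge0// ltW.
- by move=> k x y; rewrite dsum_singleP linearP.
- move=> v; apply: (le_trans (fM _)).
  by rewrite norm_dsum_single -mulrA [`|unit_vec E n| * _]mulrC.
Qed.

Definition dsum_head N x : T := \sum_(n < N) dsum_single (x n).

Lemma dsum_headE N x i : dsum_head N x i = if (i < N)%N then x i else 0.
Proof.
rewrite /dsum_head; elim: N => [|N ih]; first by rewrite big_ord0.
rewrite big_ord_recr -[LHS]/((\sum_(n < N) dsum_single (x n)) i + _) ih/=.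
rewrite [in RHS]ltnS [in RHS]leq_eqVlt.
case: dfwithP => [|j Nj]; first by rewrite ltnn eqxx add0r.
by rewrite eq_sym (negbTE Nj) addr0.
Qed.

(** Lives in [E], so that it can be compared with blocks of a scalar series; its norm is that of
    [x - dsum_head N x]. *)
Definition norm_tail N x : E := norm_seq x - psum (fun n => `|x n|) N.

Lemma norm_dsum_tail N x : `|x - dsum_head N x| = `|norm_tail N x|.
Proof.
rewrite dsum_normE; congr `|_|; apply: coord_inj.
rewrite linearB/= coord_psum !coord_norm_seq; apply/funext => i.
rewrite -[LHS]/(`|x i - dsum_head N x i|) dsum_headE.
rewrite -[RHS]/(`|x i| - (if (i < N)%N then `|x i| else 0)).
by case: ifP => _; rewrite ?subrr ?normr0// !subr0.
Qed.

Lemma psum_cvg x : psum (fun n => `|x n|) @ \oo --> norm_seq x.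
Proof. by have := @unit_vec_expansion K E (norm_seq x); rewrite coord_norm_seq. Qed.
End DirectSumTheory.

(** * Weakly open sets with small tails *)

Section TailShrinking.
Variables (K : numFieldType) (E : seqSpace K) (hE : one_unconditional E).
Variable X : nat -> completeNormedModType K.
Local Notation T := (dsum hE X).
Hypothesis normK : norming K.

(** A norming functional for the coordinate, pulled back to the sum, loses at most half of its
    modulus on a weak neighbourhood of [x]. *)
Lemma weak_nbhs_coord (n : nat) (x : weak T) :
  nbhs x [set y : weak T | `|(x : T) n| / 2 <= `|(y : T) n|].
Proof.
have [x0|x0] := eqVneq `|(x : T) n| 0.
  by apply: filterS (filterT (F := nbhs x)) => y _ /=; rewrite x0 mul0r.
have [f [f1 fx]] := normK ((x : T) n).
have [g gf] := dual_proj hE f.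
have x2 : 0 < `|(x : T) n| / 2 by rewrite divr_gt0// lt_def x0/=.
apply: filterS (weak_nbhs_dual g x x2) => y /=; rewrite !gf => yx.
apply: le_trans (f1 _).
rewrite -(lerD2l (`|(x : T) n| / 2)) -splitr -{1}fx.
have -> : f ((x : T) n) = - (f ((y : T) n) - f ((x : T) n)) + f ((y : T) n).
  by rewrite opprB subrK.
by apply: le_trans (ler_normD _ _) _; rewrite normrN lerD2r ltW.
Qed.

Lemma weak_nbhs_coords (m : nat) (x : weak T) :
  nbhs x [set y : weak T | forall n, (n < m)%N ->
    `|(x : T) n| / 2 <= `|(y : T) n|].
Proof.
elim: m => [|m ih]; first by apply: filterS (filterT (F := nbhs x)) => y _.
apply: filterS2 ih (weak_nbhs_coord m x) => y /= yn ym n.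
by rewrite ltnS leq_eqVlt => /predU1P[->//|/yn].
Qed.

Hypothesis hE' : boundedly_complete E.
Variables (C : set T) (M : K).
Hypothesis CM : forall x, C x -> `|x| <= M.

(* If all tails stay large on every smaller weakly open set, blocks of norm at
   least [e / 4] can be frozen one after the other: once [x] has a large block,
   the coordinates of nearby points have at least half the norm of those of [x].
   The halved norms form a sequence [a] with partial sums bounded by [M] that
   do not converge. *)
Lemma weak_open_small_tail (O : set (weak T)) (e : K) :
  open O -> O `&` C !=set0 -> 0 < e ->
  exists N, exists2 V : set (weak T), open V /\ V `<=` O &
    V `&` C !=set0 /\ forall x : T, V x -> C x -> `|norm_tail N x| < e.
Proof.
move=> Oo OC e0; apply: contrapT => H.
have {}H N (V : set (weak T)) : open V -> V `<=` O -> V `&` C !=set0 ->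
    exists x : T, [/\ V x, C x & e <= `|norm_tail N x|].
  move=> Vo VO VC; apply: contrapT => nx; apply: H; exists N, V => //.
  split=> // x Vx Cx; rewrite real_ltNge ?normr_real ?gtr0_real//.
  by apply/negP => ex; apply: nx; exists x.
pose state := (nat * (nat -> K) * set (weak T))%type.
pose inv (s : state) := [/\ open s.2, s.2 `<=` O, s.2 `&` C !=set0 &
  forall x : T, s.2 x -> forall n, (n < s.1.1)%N -> `|s.1.2 n| <= `|x n|].
pose step (s s' : state) := [/\ (s.1.1 < s'.1.1)%N,
  forall n, (n < s.1.1)%N -> s'.1.2 n = s.1.2 n &
  e / 4 <= `|psum E s'.1.2 s'.1.1 - psum E s'.1.2 s.1.1|].
have stepP s : exists s', inv s -> inv s' /\ step s s'.
  have [si|si] := pselect (inv s); last by exists s.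
  case: s si => -[N a] V [/= Vo VO VC Va].
  have [x [Vx Cx ex]] := H N V Vo VO VC.
  (* The partial sums converge to [norm_seq x], so a long enough block starting at [N] keeps [e / 2]
     of the tail; [N.+1] in the maximum forces strict growth. *)
  have [m Nm mx] : exists2 m, (N < m)%N &
      e / 2 <= `|psum E (fun n => `|x n|) m - psum E (fun n => `|x n|) N|.
    have e2 : 0 < e / 2 by rewrite divr_gt0.
    have /cvgrPdist_lt/(_ _ e2) [m0 _ m0P] := @psum_cvg _ _ _ _ x.
    exists (maxn m0 N.+1); first by rewrite leq_maxr.
    have /= /ltW mx := m0P (maxn m0 N.+1) (leq_maxl _ _).
    rewrite -(lerD2l (e / 2)) -splitr (le_trans ex)//.
    apply: le_trans (_ : _ <= _ + _) (lerD mx (lexx _)).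
    by rewrite (le_trans _ (ler_normD _ _))// addrA subrK.
  (* The halves are what [weak_nbhs_coords] preserves; they turn [e / 2] into [e / 4]. *)
  pose a' n := if (n < N)%N then a n else `|x n| / 2.
  exists (m, a', V `&` [set y : weak T | forall n, (n < m)%N ->
    `|(x : T) n| / 2 <= `|(y : T) n|]°) => _.
  split; last first.
    split=> //= [n nN|]; first by rewrite /a' nN.
    rewrite (eq_psumB _ (b := fun n => 2^-1 * `|x n|)); last exact: ltnW.
    - rewrite !psumZ -scalerBr normrZ normfV normr_nat.
      rewrite (_ : 4 = 2 * 2 :> K); last by rewrite -natrM.
      by rewrite invfM mulrCA ler_wpM2l// invr_ge0.
    - by move=> i /andP[Ni _]; rewrite /a' ltnNge Ni/= mulrC.
  split=> /=.
  - by apply: openI => //; exact: open_interior.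
  - by move=> y [/VO].
  - by exists x; split=> //; split=> //; exact: weak_nbhs_coords.
  - move=> y [Vy /interior_subset/= yx] n nm; rewrite /a'.
    case: ifP => nN; first exact: Va.
    by rewrite ger0_norm ?divr_ge0// yx.
have [F FP] := choice stepP.
pose s k := iter k F (0%N, fun=> 0, O).
have sI k : inv (s k).
  by elim: k => [|k ih]; [split|exact: (FP _ ih).1].
have sS k : step (s k) (s k.+1) by exact: (FP _ (sI k)).2.
have Nlt k : (k <= (s k).1.1)%N.
  by elim: k => // k ih; apply: leq_ltn_trans ih _; case: (sS k).
have Nmono j k : (j <= k)%N -> ((s j).1.1 <= (s k).1.1)%N.
  elim: k => [|k ih]; first by rewrite leqn0 => /eqP->.
  rewrite leq_eqVlt => /predU1P[->//|/ih jk].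
  by apply: leq_trans jk (ltnW _); case: (sS k).
have aconst j k n : (j <= k)%N -> (n < (s j).1.1)%N ->
    (s k).1.2 n = (s j).1.2 n.
  elim: k => [|k ih]; first by rewrite leqn0 => /eqP->.
  rewrite leq_eqVlt => /predU1P[->//|jk] nj.
  rewrite -ih//; case: (sS k) => _ + _; apply.
  exact: leq_trans nj (Nmono _ _ _).
pose a n := (s n.+1).1.2 n.
have aE k n : (n < (s k).1.1)%N -> a n = (s k).1.2 n.
  move=> nk; rewrite /a; have [kn|/ltnW kn] := leqP k n.+1.
  - exact: aconst.
  - by rewrite (aconst _ _ _ kn)//; exact: Nlt.
(* A point of [C] in the open set of stage [m] dominates the first [m] entries. *)
have abd m : `|psum E a m| <= M.
  have [_ _ [x [sx Cx]] ax] := sI m.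
  apply: le_trans (CM Cx); apply: psum_le_norm => i im.
  have iN : (i < (s m).1.1)%N by exact: leq_trans im (Nlt m).
  by rewrite (aE _ _ iN) ax.
have : cvgn (psum E a).
  apply: hE'; exists M; split; first by rewrite ger0_real// (le_trans _ (abd 0%N)).
  by move=> N MN m _; apply: le_trans (abd m) (ltW MN).
move=> /cvg_cauchy/cauchy_seriesP/(_ (e / 4)).
have e4 : 0 < e / 4 by rewrite divr_gt0.
move=> /(_ e4) [[P Q] [/= [p _ pP] [q _ qQ]] PQ].
set k := maxn p q.
have [kk' _ ek] := sS k.
have PQk : (P `*` Q) ((s k).1.1, (s k.+1).1.1).
  split; first by apply: pP; apply: leq_trans (Nlt k); exact: leq_maxl.
  apply: qQ; apply: leq_trans (leq_trans (Nlt k) (ltnW kk')).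
  exact: leq_maxr.
have : e / 4 <= `|psum E a (s k.+1).1.1 - psum E a (s k).1.1|.
  apply: (le_trans ek); rewrite (eq_psumB _ (b := a))// ?(ltnW kk')//.
  by move=> i /andP[_ ik]; rewrite (aE k.+1).
rewrite /psum sub_series (ltnW kk') => {}ek.
have /= ek' := PQ _ PQk.
by have := le_lt_trans ek ek'; rewrite ltxx.
Qed.
End TailShrinking.

(** * The countable family of traces and its density *)

Section CountablePiBase.
Variables (K : numFieldType) (E : seqSpace K) (hE : one_unconditional E).
Variable X : nat -> completeNormedModType K.
Local Notation T := (dsum hE X).
Hypotheses (normK : norming K) (supK : has_suprema K).
Variables (Q : set K) (Qc : separable_scalars Q).

(** A scalar within [e / 2] of [e / 2] is nonzero and has modulus below [e]. *)
Lemma separable_radius (e : K) : 0 < e -> exists2 r, Q r & 0 < `|r| /\ `|r| < e.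
Proof.
move=> e0; have e2 : 0 < e / 2 by rewrite divr_gt0.
have [r Qr re] := Qc.2 (e / 2) _ e2; exists r => //; split.
  rewrite normr_gt0; apply/eqP => r0; move: re.
  by rewrite r0 subr0 gtr0_norm// ltxx.
rewrite -(subrK (e / 2) r) [ltRHS]splitr (le_lt_trans (ler_normD _ _))//.
by rewrite (gtr0_norm e2) ltrD2r distrC.
Qed.

Variable D : forall n, set (dual (X n)).
Hypothesis Dc : forall n, countable (@D n).
Hypothesis Dd : forall n (f : dual (X n)) (e : K), 0 < e ->
  exists2 g, @D n g & opnorm (fun x => f x - g x) < e.

(** The triple holds functional, centre and radius; the modulus turns any scalar of [Q] into a
    radius. *)
Definition coord_ball n (p : dual (X n) * K * K) : set T :=
  [set x : T | `|p.1.1 (x n) - p.1.2| < `|p.2|].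

Definition coord_balls : set (set T) :=
  \bigcup_n @coord_ball n @` (@D n `*` Q `*` Q).

Definition coord_cells : set (set T) := finI_from coord_balls id.

Lemma countable_coord_cells : countable coord_cells.
Proof.
apply: finI_from_countable; apply: bigcup_countable => // n _.
apply: sub_countable (card_image_le _ _) _.
by apply: countableX; [apply: countableX => //|]; exact: Qc.1.
Qed.

Lemma coord_cellsT : coord_cells setT.
Proof. by exists finmap.fset0 => //; rewrite set_fset0 bigcap_set0. Qed.

Variables (C : set T) (M : K).
Hypotheses (M0 : 0 < M) (CM : forall x, C x -> `|x| <= M).

(** As [C] is bounded, a functional of the dense family that is close to [g] in norm is uniformly
    close to it on the differences [x n - v n]; a ball of that functional then controls [g]. *)
Lemma coord_cell_dual n (g : dual (X n)) (v : T) (e : K) : C v -> 0 < e ->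
  exists2 B, coord_cells B & nbhs (v : weak T) B /\
    forall x, B x -> C x -> `|g (x n - v n)| < e.
Proof.
move=> Cv e0; pose c := (M + M) / `|unit_vec E n|.
have c0 : 0 < c by rewrite divr_gt0 ?addr_gt0 ?norm_unit_vec_gt0.
have xv x : C x -> `|x n - v n| <= c.
  move=> Cx; rewrite ler_pdivlMr ?norm_unit_vec_gt0//.
  apply: le_trans (dsum_coord_le n (x - v)) _.
  by apply: le_trans (ler_normB _ _) _; apply: lerD; exact: CM.
have e2 : 0 < e / 2 by rewrite divr_gt0.
have [d Dnd dg] := Dd g (divr_gt0 e2 c0).
have gd x : C x -> `|g (x n - v n) - d (x n - v n)| <= e / 2.
  move=> Cx.
  have /linear_bounded_continuous/linear_boundedP/pinfty_ex_gt0[a a0 ga] :=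
    @dual_continuous _ _ g.
  have /linear_bounded_continuous/linear_boundedP/pinfty_ex_gt0[b b0 db] :=
    @dual_continuous _ _ d.
  (* [le_opnorm] needs a continuous linear map, so the difference is packed as an element of the
     dual. *)
  have [|||h hE'] := @ex_dual _ _ (fun z => g z - d z) (a + b).
  - by rewrite addr_ge0// ltW.
  - by move=> k y z; rewrite !linearP/= scalerN mulrBr addrACA.
  - move=> z; apply: le_trans (ler_normB _ _) _; rewrite mulrDl.
    by apply: lerD; [exact: ga|exact: db].
  rewrite -hE'; apply: le_trans (le_opnorm supK (@dual_continuous _ _ h) _) _.
  have -> : opnorm h = opnorm (fun z => g z - d z).
    by congr opnorm; apply/funext => z; rewrite hE'.
  apply: le_trans (ler_wpM2r (normr_ge0 _) (ltW dg)) _.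
  apply: le_trans (ler_wpM2l (ltW (divr_gt0 e2 c0)) (xv _ Cx)) _.
  by rewrite divfK ?lt0r_neq0.
(* Replacing [g] by [d] costs [e / 2]; the distances of [d (x n)] and [d (v n)] to the centre [q]
   cost less than [e / 4] each. *)
have e4 : 0 < e / 2 / 2 by rewrite divr_gt0.
have [r Qr [r0 re]] := separable_radius e4.
have r2 : 0 < `|r| / 2 by rewrite divr_gt0.
(* A centre within [|r| / 2] of [d (v n)] leaves room in the ball of radius [|r|] for a weak
   neighbourhood of [v]. *)
have [q Qq dq] := Qc.2 (d (v n)) _ r2.
exists (coord_ball (d, q, r)).
  by apply: finI_from1; exists n => //; exists (d, q, r).
have [f fd] := dual_proj hE d.
split.
  apply: filterS (weak_nbhs_dual f (v : weak T) r2) => x /=.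
  rewrite !fd /coord_ball/= => xr.
  rewrite -(subrK (d (v n)) (d (x n))) -addrA [ltRHS]splitr.
  by rewrite (le_lt_trans (ler_normD _ _))// ltrD.
move=> x /= xr Cx; rewrite -(subrK (d (x n - v n)) (g (x n - v n))).
rewrite [ltRHS]splitr (le_lt_trans (ler_normD _ _))//.
apply: ler_ltD; first exact: gd.
rewrite linearB -(subrKA q) [ltRHS]splitr (le_lt_trans (ler_normD _ _))//.
apply: ltrD; first exact: lt_trans xr re.
rewrite distrC (lt_trans dq)// (lt_trans _ re)//.
by rewrite [ltRHS]splitr ltrDl.
Qed.

(** The head is a finite sum of single coordinates, on each of which [f] acts as a functional on
    [X n]. *)
Lemma coord_cell_head (f : dual T) N (v : T) (e : K) : C v -> 0 < e ->
  exists2 B, coord_cells B & nbhs (v : weak T) B /\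
    forall x, B x -> C x -> `|f (dsum_head N (x - v))| < e.
Proof.
move=> Cv; elim: N e => [|N ih] e e0.
  exists setT; first exact: coord_cellsT.
  split; first exact: (@filterT _ (nbhs (v : weak T))).
  by move=> x _ _; rewrite /dsum_head big_ord0 linear0 normr0.
have e2 : 0 < e / 2 by rewrite divr_gt0.
have [g gf] := dual_single N f.
have [B cB [vB Bh]] := ih _ e2.
have [B' cB' [vB' Bg]] := coord_cell_dual g Cv e2.
exists (B `&` B'); first exact: finI_fromI.
split; first exact: filterI.
move=> x [Bx B'x] Cx; rewrite /dsum_head big_ord_recr linearD/= [ltRHS]splitr.
rewrite (le_lt_trans (ler_normD _ _))//; apply: ltrD; first exact: Bh.
by rewrite -gf; exact: Bg.
Qed.

Lemma coord_cell_semi (fs : seq (dual T)) N (v : T) (e : K) : C v -> 0 < e ->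
  exists2 B, coord_cells B & nbhs (v : weak T) B /\
    forall x, B x -> C x -> weak_semi fs (dsum_head N (x - v)) < e.
Proof.
move=> Cv; elim: fs e => [|f fs ih] e e0.
  exists setT; first exact: coord_cellsT.
  split; first exact: (@filterT _ (nbhs (v : weak T))).
  by move=> x _ _; rewrite /weak_semi big_nil.
have e2 : 0 < e / 2 by rewrite divr_gt0.
have [B cB [vB Bh]] := ih _ e2.
have [B' cB' [vB' Bg]] := coord_cell_head f N Cv e2.
exists (B `&` B'); first exact: finI_fromI.
split; first exact: filterI.
move=> x [Bx B'x] Cx; rewrite /weak_semi big_cons [ltRHS]splitr.
by apply: ltrD; [exact: Bg|exact: Bh].
Qed.

Local Notation S := (set_type (C : set (weak T))).

(** The interior is taken because a bound on the tail norm need not define a relatively weakly open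
    set. *)
Definition cell_trace (p : set T * nat * K) : set S :=
  [set x : S | p.1.1 (set_val x) /\
    `|norm_tail p.1.2 (set_val x)| < `|p.2|]°.

Lemma has_countable_pi_base_dsum : boundedly_complete E ->
  has_countable_pi_base S.
Proof.
move=> hE'.
exists [set A | (cell_trace @` (coord_cells `*` setT `*` Q)) A /\ A !=set0].
  apply: (@sub_countable _ _ _ (coord_cells `*` [set: nat] `*` Q)).
    apply: card_le_trans (card_image_le cell_trace _).
    by apply: subset_card_le => A [].
  apply: countableX; last exact: Qc.1.
  by apply: countableX => //; exact: countable_coord_cells.
split=> [A [[p _ <-] A0] | O [U Uo <-] [x0 Ux0]].
  by split=> //; exact: open_interior.
have [fs [e e0 fsO]] := weak_nbhsP (open_nbhs_nbhs (conj Uo Ux0)).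
have e2 : 0 < e / 2 by rewrite divr_gt0.
have e4 : 0 < e / 2 / 2 by rewrite divr_gt0.
have e8 : 0 < e / 2 / 2 / 2 by rewrite divr_gt0.
have [L L0 fsL] := weak_semi_bounded fs.
(* A tail of norm below [|r|] contributes less than [e / 8] to [weak_semi fs]. *)
have [r Qr [r0 rL]] := separable_radius (divr_gt0 e8 L0).
(* Half of [e] is reserved for moving from [x0] to a point [v] with small tails nearby. *)
pose O' : set (weak T) :=
  [set y : weak T | weak_semi fs ((y : T) - (set_val x0 : T)) < e / 2]°.
have O'x0 : O' (set_val x0) by exact: weak_nbhs_semi.
have Cx (x : S) : C (set_val x) by exact: set_mem (valP x).
have [N [V [Vo VO'] [[v [Vv Cv]] Vtail]]] :=
  weak_open_small_tail normK hE' CM (@open_interior _ _)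
    (ex_intro _ _ (conj O'x0 (Cx x0))) r0.
have [B cB [vB Bfs]] := coord_cell_semi fs N Cv e4.
exists (cell_trace (B, N, r)).
  split; first by exists (B, N, r).
  exists (SigSub (mem_set Cv)).
  (* The point [v] witnesses nonemptiness: all points of [C] in [B] and [V] satisfy both conditions
     of the trace. *)
  have vBV : nbhs (v : weak T) (B `&` V).
    by apply: filterI => //; exact: open_nbhs_nbhs.
  pose w : S := SigSub (mem_set Cv).
  have wBV : nbhs w (set_val @^-1` (B `&` V)).
    exact: (@initial_continuous _ (weak T) (set_val : S -> weak T) w _ vBV).
  apply: (@filterS S (nbhs w) _ _ _ _ wBV) => x [Bx Vx]; split=> //.
  by apply: Vtail => //; exact: Cx.
move=> x /interior_subset/= [Bx tx]; apply: fsO.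
set y : T := set_val x; set y0 : T := set_val x0.
have tail_lt z : `|norm_tail N z| < `|r| ->
    weak_semi fs (z - dsum_head N z) < e / 2 / 2 / 2.
  move=> zr; apply: le_lt_trans (fsL _) _.
  by rewrite norm_dsum_tail -ltr_pdivlMl// mulrC (lt_trans zr).
have headB : dsum_head N (y - v) =
    dsum_head N y - dsum_head N v.
  apply: dsumP => i; rewrite dsum_headE.
  rewrite -[RHS]/(dsum_head N y i - dsum_head N v i).
  by rewrite !dsum_headE; case: ifP => // _; rewrite subrr.
(* The terms cost [e / 2], [e / 4] and twice [e / 8]. The tail of [y] is small by membership in the
   trace, even if [y] lies outside [V]. *)
have -> : y - y0 = (v - y0) + (dsum_head N (y - v) +
    ((y - dsum_head N y) - (v - dsum_head N v))).
  rewrite headB opprB (addrACA (dsum_head N y)) subrKC.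
  by rewrite addKr [RHS]addrC subrKA.
apply: le_lt_trans (weak_semiD _ _ _) _; rewrite [ltRHS]splitr.
apply: ltrD; first exact: (interior_subset (VO' _ Vv)).
apply: le_lt_trans (weak_semiD _ _ _) _; rewrite [ltRHS]splitr.
apply: ltrD; first by apply: Bfs => //; exact: Cx.
apply: le_lt_trans (weak_semiD _ _ _) _; rewrite [ltRHS]splitr weak_semiN.
by apply: ltrD; apply: tail_lt => //; exact: Vtail.
Qed.
End CountablePiBase.


Unset Implicit Arguments.
Set Strict Implicit.

Theorem proposition5p5 (R : realType) (K : numFieldType)
  (hK : K = (R : numFieldType) \/ K = (R[i] : numFieldType))
  (E : seqSpace K) (hE : one_unconditional E) (hE' : boundedly_complete E)
  (X : nat -> completeNormedModType K)
  (hX : forall n, dual_separable (X n))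
  (C : set (dsum hE X)) (hCb : bounded_set C) (hCc : convex_set C) :
  has_countable_pi_base (set_type (C : set (weak (dsum hE X)))).
Proof.
(* The choice of scalar field enters the argument only through these three properties. *)
have [normK [supK [Q Qc]]] :
    norming K /\ has_suprema K /\ exists Q : set K, separable_scalars Q.
  case: hK => ->; split; [exact: norming_real|split|exact: norming_complex|split].
  - exact: has_suprema_real.
  - exact: separable_scalars_real.
  - exact: has_suprema_complex.
  - exact: separable_scalars_complex.
have [M M0 CM] := pinfty_ex_gt0 hCb.
pose D n := s2val (cid2 (hX n)).
apply: (has_countable_pi_base_dsum normK supK Qc (D := D) _ _ M0 CM hE').
- by move=> n; exact: s2valP (cid2 (hX n)).
- by move=> n; exact: s2valP' (cid2 (hX n)).
Qed.
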